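(* Let $k$ be a nonzero real number. The Tremblay-Turbiner-Winternitz potential $$V(r,\theta)=-\omega r^2+\frac{\alpha}{r^2\cos^2 k\theta}+\frac{\beta}{r^2\sin^2 k\theta}$$ on the Euclidean plane, with $\omega,\alpha,\beta$ arbitrary real parameters (that is, for all values of $\omega,\alpha,\beta$), is a multi-separable superintegrable potential if and only if $k=\pm1$.
   Context: $(r,\theta)$ are polar coordinates on the Euclidean plane $\mathbb{E}^2$ with conjugate momenta $(p_r,p_\theta)$. The Hamiltonian is the natural Hamiltonian $H=p_r^2+\frac{1}{r^2}p_\theta^2+V(r,\theta)$, considered on the region where $V$ is defined. A potential is called multi-separable superintegrable (in the sense used here) if the Hamiltonian system with Hamiltonian $H$ admits, besides $H$, two further first integrals $F_1,F_2$ which are quadratic in the momenta, i.e. of the form $F=K^{ij}(q)p_ip_j+U(q)$, such that $H,F_1,F_2$ are functionally independent; here $K^{ij}$ are then necessarily the components of Killing two-tensors of $\mathbb{E}^2$. The system with Hamiltonian $H$ always admits one such first integral, associated with separation of variables in polar coordinates. *)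

(* Defs.v *)
From Stdlib Require Import Reals.
From Coquelicot Require Import Coquelicot.
Open Scope R_scope.

(** Functions of (r, theta, p_r, p_theta). *)
Definition phase_fun := R -> R -> R -> R -> R.

Definition d_r (F : phase_fun) : phase_fun :=
  fun r t pr pt => Derive (fun x => F x t pr pt) r.
Definition d_t (F : phase_fun) : phase_fun :=
  fun r t pr pt => Derive (fun x => F r x pr pt) t.
Definition d_pr (F : phase_fun) : phase_fun :=
  fun r t pr pt => Derive (fun x => F r t x pt) pr.
Definition d_pt (F : phase_fun) : phase_fun :=
  fun r t pr pt => Derive (fun x => F r t pr x) pt.

Definition poisson (F G : phase_fun) : phase_fun :=
  fun r t pr pt =>
    d_r F r t pr pt * d_pr G r t pr pt - d_pr F r t pr pt * d_r G r t pr pt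
    + (d_t F r t pr pt * d_pt G r t pr pt - d_pt F r t pr pt * d_t G r t pr pt).

Definition natural_hamiltonian (V : R -> R -> R) : phase_fun :=
  fun r t pr pt => pr ^ 2 + / r ^ 2 * pt ^ 2 + V r t.

Definition smooth_on (D : R -> R -> Prop) (f : R -> R -> R) : Prop :=
  forall (n : nat) (r t : R), D r t -> ex_diff_n f n r t.

Definition quadratic_in_momenta (D : R -> R -> Prop) (F : phase_fun) : Prop :=
  exists Krr Krt Ktt U : R -> R -> R,
    smooth_on D Krr /\ smooth_on D Krt /\ smooth_on D Ktt /\ smooth_on D U /\
    forall r t pr pt : R, D r t ->
      F r t pr pt =
      Krr r t * pr ^ 2 + 2 * Krt r t * (pr * pt) + Ktt r t * pt ^ 2 + U r t.

Definition first_integral (D : R -> R -> Prop) (H F : phase_fun) : Prop :=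
  forall r t pr pt : R, D r t -> poisson H F r t pr pt = 0.

Definition differentials_independent (F G H : phase_fun) (r t pr pt : R) : Prop :=
  forall a b c : R,
    a * d_r F r t pr pt + b * d_r G r t pr pt + c * d_r H r t pr pt = 0 ->
    a * d_t F r t pr pt + b * d_t G r t pr pt + c * d_t H r t pr pt = 0 ->
    a * d_pr F r t pr pt + b * d_pr G r t pr pt + c * d_pr H r t pr pt = 0 ->
    a * d_pt F r t pr pt + b * d_pt G r t pr pt + c * d_pt H r t pr pt = 0 ->
    a = 0 /\ b = 0 /\ c = 0.

(** The differentials are linearly independent on a dense subset of the phase
    space over [D] (for C^1 functions the set of such points is open).
    Independence everywhere would be too strong: the differentials of the
    momentum-quadratic integrals of a natural system degenerate, e.g., at rest
    points. *)
Definition functionally_independent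
    (D : R -> R -> Prop) (F G H : phase_fun) : Prop :=
  forall r t pr pt eps : R, D r t -> 0 < eps ->
    exists r' t' pr' pt' : R,
      D r' t' /\
      Rabs (r' - r) < eps /\ Rabs (t' - t) < eps /\
      Rabs (pr' - pr) < eps /\ Rabs (pt' - pt) < eps /\
      differentials_independent F G H r' t' pr' pt'.

Definition multiseparable_superintegrable
    (D : R -> R -> Prop) (V : R -> R -> R) : Prop :=
  let H := natural_hamiltonian V in
  exists F1 F2 : phase_fun,
    quadratic_in_momenta D F1 /\ quadratic_in_momenta D F2 /\
    first_integral D H F1 /\ first_integral D H F2 /\
    functionally_independent D H F1 F2.

Definition ttw_potential (k omega alpha beta : R) : R -> R -> R :=
  fun r t =>
    - omega * r ^ 2 + alpha / (r ^ 2 * cos (k * t) ^ 2)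
    + beta / (r ^ 2 * sin (k * t) ^ 2).

(** Polar coordinates of the points of the plane at which the TTW potential is
    defined.  The angle is taken in (0, 2 PI) rather than [0, 2 PI): the ray
    t = 0 is always excluded by [sin (k * t) <> 0], so nothing is lost and the
    region is open. *)
Definition ttw_region (k : R) : R -> R -> Prop :=
  fun r t =>
    0 < r /\ 0 < t < 2 * PI /\ cos (k * t) <> 0 /\ sin (k * t) <> 0.

(* Main.v *)
(* Write the potential as [- omega * r ^ 2 + W theta / r ^ 2].  For a quadratic
   integral [A p_r^2 + 2 B p_r p_theta + C p_theta^2 + U], the Killing equations
   give [A = a theta] and [B = a' / (2 r) + b theta].  If [omega <> 0], the
   equations for [U] force [b = 0], and [f = a'] satisfies [f'' = - 4 f] and
   [f W'' + 3 f' W' - 8 f W = 0].  If [f = 0], the differential of the integral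
   is a combination of those of [H] and of [p_theta^2 + W], so two such
   integrals are dependent together with [H].  Otherwise
   [f^2 W = E F + D] with [F' = f], [E] and [D] constant; after multiplication by
   [sin^2 (k theta) cos^2 (k theta)] this is an identity between trigonometric
   sums, which extends from an interval to the whole line.  Comparing zeros:
   at [0], [f] is proportional to [sin (2 theta)]; at [PI / (2 k)], [1 / k] is
   an integer; at [PI / 2] and [PI], only [k = 1, -1, 1/2, -1/2] survive, and
   the last two require [alpha = beta].  Conversely, for [k = 1] or [k = -1] the
   system separates in Cartesian coordinates too. *)

Require Import Defs.
From Stdlib Require Import Reals Lra Lia Psatz List Znumtheory Classical.
From Coquelicot Require Import Coquelicot.
Open Scope R_scope.

(** * Vanishing derivatives and uniqueness for the harmonic oscillator equation *)

Lemma is_derive_zero_eq (f : R -> R) (x y : R) :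
  (forall z, Rmin x y <= z <= Rmax x y -> is_derive f z 0) -> f x = f y.
Proof.
  intros Hf.
  destruct (MVT_gen f x y (fun _ => 0)) as [c [_ Hc]]; [| | lra].
  - intros z Hz; apply Hf; lra.
  - intros z Hz; apply derivable_continuous_pt; exists 0.
    now apply is_derive_Reals, Hf.
Qed.

Lemma open_interval_locally (x1 x2 t : R) :
  x1 < t < x2 -> locally t (fun z : R => x1 < z < x2).
Proof.
  intros Ht.
  apply (open_and (fun z : R => x1 < z) (fun z : R => z < x2));
    [apply open_gt | apply open_lt | exact Ht].
Qed.

Lemma is_derive_eq_interval (f g : R -> R) (x1 x2 t l1 l2 : R) :
  (forall z, x1 < z < x2 -> f z = g z) -> x1 < t < x2 ->
  is_derive f t l1 -> is_derive g t l2 -> l1 = l2.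
Proof.
  intros Hfg Ht Hf Hg.
  rewrite <- (is_derive_unique _ _ _ Hf), <- (is_derive_unique _ _ _ Hg).
  apply Derive_ext_loc.
  apply (filter_imp (fun z : R => x1 < z < x2)); [exact Hfg |].
  now apply open_interval_locally.
Qed.

(* The energy [f1 ^ 2 + w ^ 2 * f ^ 2] is conserved. *)
Lemma harmonic_oscillator_zero (f f1 : R -> R) (w x1 x2 x0 : R) :
  (forall t, x1 < t < x2 -> is_derive f t (f1 t)) ->
  (forall t, x1 < t < x2 -> is_derive f1 t (- w ^ 2 * f t)) ->
  x1 < x0 < x2 -> f x0 = 0 -> f1 x0 = 0 ->
  forall t, x1 < t < x2 -> f t = 0.
Proof.
  intros Hf Hf1 Hx0 H0 H10.
  assert (Hconv : forall t z, x1 < t < x2 -> Rmin x0 t <= z <= Rmax x0 t ->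
    x1 < z < x2).
  { intros t z Ht; unfold Rmin, Rmax; destruct (Rle_dec x0 t); lra. }
  (* Zero energy always kills [f1], but says nothing about [f] when [w = 0]; so [f] is treated
     afterwards, as a function with zero derivative. *)
  assert (E : forall t, x1 < t < x2 -> f1 t = 0).
  { intros t Ht.
    assert (He : f1 x0 ^ 2 + w ^ 2 * f x0 ^ 2 = f1 t ^ 2 + w ^ 2 * f t ^ 2).
    { apply (is_derive_zero_eq (fun z => f1 z ^ 2 + w ^ 2 * f z ^ 2)).
      intros z Hz; specialize (Hconv t z Ht Hz).
      specialize (Hf z Hconv); specialize (Hf1 z Hconv).
      auto_derive.
      - repeat split; [now exists (- w ^ 2 * f z) | now exists (f1 z)].
      - replace (Derive (fun x => f x) z) with (f1 z)
          by (symmetry; now apply is_derive_unique).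
        replace (Derive (fun x => f1 x) z) with (- w ^ 2 * f z)
          by (symmetry; now apply is_derive_unique).
        ring. }
    rewrite H0, H10 in He.
    assert (0 <= (w * f t) ^ 2) by apply pow2_ge_0.
    assert (0 <= f1 t ^ 2) by apply pow2_ge_0.
    assert (f1 t ^ 2 = 0) by nra.
    nra. }
  intros t Ht; rewrite <- H0; symmetry.
  apply is_derive_zero_eq; intros z Hz.
  rewrite <- (E z (Hconv t z Ht Hz)); apply Hf, (Hconv t z Ht Hz).
Qed.

(** * Trigonometric sums *)

(** Frequencies are arbitrary reals because [k] is one. The phases let sines and, at frequency 0,
    constants be written as cosines. *)
Fixpoint trig_sum (l : list (R * R * R)) (t : R) : R :=
  match l with
  | nil => 0
  | (a, w, p) :: l' => a * cos (w * t + p) + trig_sum l' t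
  end.

Fixpoint trig_sum_deriv (l : list (R * R * R)) (t : R) : R :=
  match l with
  | nil => 0
  | (a, w, p) :: l' => - a * w * sin (w * t + p) + trig_sum_deriv l' t
  end.

(** The factor depends on the frequency: [- w ^ 2] gives the second derivative [g''], and
    [v ^ 2 - w ^ 2] gives [g'' + v ^ 2 * g]. *)
Definition scale_amplitudes (c : R -> R) (l : list (R * R * R)) :=
  map (fun x => let '(a, w, p) := x in (c w * a, w, p)) l.

Lemma is_derive_trig_sum l t :
  is_derive (trig_sum l) t (trig_sum_deriv l t).
Proof.
  induction l as [| [[a w] p] l IH]; simpl.
  - apply (is_derive_const (V := R_NormedModule)).
  - apply @is_derive_plus; [| exact IH].
    auto_derive; [easy | ring].
Qed.

Lemma is_derive_trig_sum_deriv l t :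
  is_derive (trig_sum_deriv l) t
    (trig_sum (scale_amplitudes (fun w => - w ^ 2) l) t).
Proof.
  induction l as [| [[a w] p] l IH]; simpl.
  - apply (is_derive_const (V := R_NormedModule)).
  - apply @is_derive_plus; [| exact IH].
    auto_derive; [easy | ring].
Qed.

Lemma trig_sum_scale_amplitudes (v : R) l t :
  trig_sum (scale_amplitudes (fun w => v ^ 2 - w ^ 2) l) t =
  trig_sum (scale_amplitudes (fun w => - w ^ 2) l) t + v ^ 2 * trig_sum l t.
Proof.
  induction l as [| [[a w] p] l IH]; simpl in *; [ring |].
  rewrite IH; ring.
Qed.

(* Induction on the number of terms: [g'' + w ^ 2 * g] loses the term of
   frequency [w], and the induction hypothesis makes [g] a solution on the
   whole line of the harmonic oscillator equation. *)
Lemma trig_sum_zero_interval (l : list (R * R * R)) (x1 x2 : R) :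
  x1 < x2 -> (forall t, x1 < t < x2 -> trig_sum l t = 0) ->
  forall t, trig_sum l t = 0.
Proof.
  intros Hx.
  remember (length l) as n eqn:Hn; revert l Hn.
  induction n as [| n IH]; intros l Hn H0.
  { now destruct l. }
  destruct l as [| [[a w] p] l]; [easy |].
  set (g := (a, w, p) :: l) in *.
  assert (Hd : forall t, x1 < t < x2 -> trig_sum_deriv g t = 0).
  { intros t Ht.
    apply (is_derive_eq_interval (trig_sum g) (fun _ => 0) x1 x2 t);
      [exact H0 | exact Ht | apply is_derive_trig_sum
      | apply (is_derive_const (V := R_NormedModule))]. }
  assert (Hdd : forall t, x1 < t < x2 ->
    trig_sum (scale_amplitudes (fun w => - w ^ 2) g) t = 0).
  { intros t Ht.
    apply (is_derive_eq_interval (trig_sum_deriv g) (fun _ => 0) x1 x2 t);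
      [exact Hd | exact Ht | apply is_derive_trig_sum_deriv
      | apply (is_derive_const (V := R_NormedModule))]. }
  assert (Htail : forall t,
    trig_sum (scale_amplitudes (fun v => - v ^ 2) g) t + w ^ 2 * trig_sum g t =
    trig_sum (scale_amplitudes (fun v => w ^ 2 - v ^ 2) l) t).
  { intros t; rewrite <- trig_sum_scale_amplitudes; simpl; ring. }
  assert (Hode : forall t,
    trig_sum (scale_amplitudes (fun v => - v ^ 2) g) t =
    - w ^ 2 * trig_sum g t).
  { intros t.
    enough (trig_sum (scale_amplitudes (fun v => w ^ 2 - v ^ 2) l) t = 0)
      by (specialize (Htail t); lra).
    apply IH.
    - unfold scale_amplitudes; rewrite length_map; simpl in Hn; lia.
    - intros z Hz; rewrite <- Htail, Hdd, H0 by easy; ring. }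
  intros t.
  pose (m := (x1 + x2) / 2).
  assert (Hm : x1 < m < x2) by (unfold m; lra).
  (* Any open interval containing both [m] and [t] serves; the initial values vanish at [m]. *)
  apply (harmonic_oscillator_zero (trig_sum g) (trig_sum_deriv g) w
    (Rmin m t - 1) (Rmax m t + 1) m).
  - intros z _; apply is_derive_trig_sum.
  - intros z _; rewrite <- Hode; apply is_derive_trig_sum_deriv.
  - generalize (Rmin_l m t) (Rmax_l m t); lra.
  - now apply H0.
  - now apply Hd.
  - generalize (Rmin_r m t) (Rmax_r m t); lra.
Qed.

Definition trigonometric (f : R -> R) : Prop :=
  exists l, forall t, f t = trig_sum l t.

Lemma trigonometric_ext f g :
  (forall t, f t = g t) -> trigonometric f -> trigonometric g.
Proof. intros E [l H]; exists l; intros t; now rewrite <- E. Qed.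

Lemma trigonometric_cos (w p : R) : trigonometric (fun t => cos (w * t + p)).
Proof. exists ((1, w, p) :: nil); intros t; simpl; ring. Qed.

Lemma trigonometric_const (c : R) : trigonometric (fun _ => c).
Proof.
  exists ((c, 0, 0) :: nil); intros t; simpl.
  rewrite Rmult_0_l, Rplus_0_l, cos_0; ring.
Qed.

Lemma trigonometric_plus f g :
  trigonometric f -> trigonometric g -> trigonometric (fun t => f t + g t).
Proof.
  intros [lf Hf] [lg Hg]; exists (lf ++ lg); intros t; rewrite Hf, Hg.
  clear Hf; induction lf as [| [[a w] p] l IH]; simpl; [ring |].
  rewrite <- IH; ring.
Qed.

(** Two nested inductions reduce to a product of two cosines, which is half the sum of the cosines
    of the sum and of the difference of the arguments. *)
Lemma trigonometric_mult f g :
  trigonometric f -> trigonometric g -> trigonometric (fun t => f t * g t).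
Proof.
  intros [lf Hf] Hg.
  apply (trigonometric_ext (fun t => trig_sum lf t * g t));
    [intros t; now rewrite Hf |].
  clear Hf f; destruct Hg as [lg Hg].
  induction lf as [| [[a w] p] l IH]; simpl.
  { apply (trigonometric_ext (fun _ => 0)); [intros; ring |].
    apply trigonometric_const. }
  apply (trigonometric_ext
    (fun t => a * cos (w * t + p) * g t + trig_sum l t * g t));
    [intros; ring |].
  apply trigonometric_plus; [| exact IH]; clear IH.
  apply (trigonometric_ext (fun t => a * cos (w * t + p) * trig_sum lg t));
    [intros; now rewrite Hg |].
  clear Hg; induction lg as [| [[b v] q] l' IH]; simpl.
  { apply (trigonometric_ext (fun _ => 0)); [intros; ring |].
    apply trigonometric_const. }
  destruct IH as [l2 H2].
  exists ((a * b / 2, w + v, p + q) :: (a * b / 2, w - v, p - q) :: l2).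
  intros t; simpl; rewrite <- H2.
  replace ((w + v) * t + (p + q)) with ((w * t + p) + (v * t + q)) by ring.
  replace ((w - v) * t + (p - q)) with ((w * t + p) - (v * t + q)) by ring.
  generalize (w * t + p) (v * t + q); intros x y.
  rewrite cos_plus, cos_minus; field.
Qed.

Lemma trigonometric_sin (w p : R) : trigonometric (fun t => sin (w * t + p)).
Proof.
  apply (trigonometric_ext (fun t => cos (w * t + (p - PI / 2))));
    [| apply trigonometric_cos].
  intros t; rewrite <- cos_shift, <- cos_neg; f_equal; ring.
Qed.

Lemma trigonometric_zero_interval f (x1 x2 : R) :
  trigonometric f -> x1 < x2 -> (forall t, x1 < t < x2 -> f t = 0) ->
  forall t, f t = 0.
Proof.
  intros [l Hl] Hx H0 t; rewrite Hl.
  apply (trig_sum_zero_interval l x1 x2 Hx).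
  intros z Hz; rewrite <- Hl; auto.
Qed.

(** * The angular equation *)

(** The hypothesis is [f ^ 2 * W = 2 * E * F + D] cleared of denominators, with
    [f = P cos 2t + Q sin 2t] and primitive [F = (P sin 2t - Q cos 2t) / 2]. Evaluation at
    well-chosen angles, possible once the identity holds on the whole line, determines [k]. *)
Lemma angular_identity_exponent (k al be T P Q E D : R) :
  k <> 0 -> 0 < T -> 0 < al -> 0 < be -> al <> be -> P <> 0 \/ Q <> 0 ->
  (forall t, 0 < t < T ->
     (P * cos (2 * t) + Q * sin (2 * t)) ^ 2 *
       (al * sin (k * t) ^ 2 + be * cos (k * t) ^ 2) =
     (E * (P * sin (2 * t) - Q * cos (2 * t)) + D) *
       (sin (k * t) ^ 2 * cos (k * t) ^ 2)) ->
  k = 1 \/ k = -1.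
Proof.
  intros Hk HT Hal Hbe Hab HPQ Hid.
  (* In the doubled angle [2 * (k * t)] the zeros of the right side are visible. Both sides are
     trigonometric, so the identity spreads from [(0, T)] to all reals. *)
  assert (Hall : forall t,
     (P * cos (2 * t) + Q * sin (2 * t)) ^ 2 *
       ((al + be) / 2 + (be - al) / 2 * cos (2 * (k * t))) =
     (E * (P * sin (2 * t) - Q * cos (2 * t)) + D) *
       (sin (2 * (k * t)) ^ 2 / 4)).
  { intros t; apply Rminus_diag_uniq; revert t.
    apply (trigonometric_zero_interval _ 0 T); [| exact HT |].
    - assert (Hc : forall w, trigonometric (fun t => cos (w * t))).
      { intros w; apply (trigonometric_ext (fun t => cos (w * t + 0)));
          [intros; now rewrite Rplus_0_r | apply trigonometric_cos]. }
      assert (Hs : forall w, trigonometric (fun t => sin (w * t))).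
      { intros w; apply (trigonometric_ext (fun t => sin (w * t + 0)));
          [intros; now rewrite Rplus_0_r | apply trigonometric_sin]. }
      pose (f t := P * cos (2 * t) + Q * sin (2 * t)).
      apply (trigonometric_ext (fun t =>
        f t * f t * ((al + be) / 2 + (be - al) / 2 * cos (2 * k * t))
        + (E * (P * sin (2 * t) + - Q * cos (2 * t)) + D)
          * (-1 / 4 * (sin (2 * k * t) * sin (2 * k * t))))).
      { intros t; unfold f; rewrite (Rmult_assoc 2 k t); field. }
      unfold f.
      repeat first [ apply trigonometric_plus | apply trigonometric_mult
                   | apply Hc | apply Hs | apply trigonometric_const ].
    - intros t Ht; specialize (Hid t Ht).
      apply Rminus_diag_eq.
      rewrite (cos_2a_cos (k * t)), (sin_2a (k * t)).
      replace ((al + be) / 2 + (be - al) / 2 *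
        (2 * cos (k * t) * cos (k * t) - 1))
        with (al * sin (k * t) ^ 2 + be * cos (k * t) ^ 2).
      + rewrite Hid; field.
      + generalize (sin2_cos2 (k * t)); unfold Rsqr; intros Hsc.
        replace (sin (k * t) ^ 2) with (1 - cos (k * t) * cos (k * t)) by lra.
        field. }
  (* At [t = 0] the right side vanishes and the left side is [P ^ 2 * be]. *)
  assert (HP : P = 0).
  { specialize (Hall 0).
    rewrite !Rmult_0_r, cos_0, sin_0 in Hall.
    assert (HP : P ^ 2 * be = 0) by lra.
    destruct (Rmult_integral _ _ HP); [nra | lra]. }
  subst P.
  assert (HQ : Q <> 0) by (destruct HPQ; lra).
  set (E' := - E * Q).
  assert (Hall' : forall t,
     Q ^ 2 * sin (2 * t) ^ 2 *
       ((al + be) / 2 + (be - al) / 2 * cos (2 * (k * t))) =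
     (E' * cos (2 * t) + D) * (sin (2 * (k * t)) ^ 2 / 4)).
  { intros t; unfold E'.
    transitivity ((0 * cos (2 * t) + Q * sin (2 * t)) ^ 2 *
       ((al + be) / 2 + (be - al) / 2 * cos (2 * (k * t)))); [ring |].
    rewrite Hall; ring. }
  clearbody E'; clear Hall Hid HPQ.
  assert (HQ2 : 0 < Q ^ 2) by (apply pow2_gt_0; exact HQ).
  (* At this angle [cos (k * t) = 0]: the right side vanishes and the left side is
     [Q ^ 2 * al * sin (PI / k) ^ 2], so [PI / k] is a multiple of [PI]. *)
  assert (Hn : exists n : Z, k * IZR n = 1).
  { specialize (Hall' (PI / (2 * k))).
    replace (2 * (k * (PI / (2 * k)))) with PI in Hall' by (field; lra).
    replace (2 * (PI / (2 * k))) with (PI / k) in Hall' by (field; lra).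
    rewrite cos_PI, sin_PI in Hall'.
    assert (Hs : Q ^ 2 * al * (sin (PI / k)) ^ 2 = 0) by lra.
    assert (0 < Q ^ 2 * al) by (apply Rmult_lt_0_compat; lra).
    assert (Hs' : sin (PI / k) = 0).
    { destruct (Rmult_integral _ _ Hs); [lra | nra]. }
    destruct (sin_eq_0_0 _ Hs') as [n Hn].
    exists n.
    assert (HPI := PI_neq0).
    apply (Rmult_eq_reg_r PI); [| exact HPI].
    replace (k * IZR n * PI) with (k * (IZR n * PI)) by ring.
    rewrite <- Hn; field; lra. }
  destruct Hn as [n Hn].
  (* Since [k = 1 / n], a zero of the sine at [j * k * PI] means that [n] divides [j]. *)
  assert (Hsin : forall j : Z, sin (IZR j * (k * PI)) = 0 ->
    exists m : Z, (m * n = j)%Z).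
  { intros j Hj; destruct (sin_eq_0_0 _ Hj) as [m Hm].
    exists m; apply eq_IZR; rewrite mult_IZR.
    assert (HPI := PI_neq0).
    assert (HJ : IZR j * k = IZR m) by (apply (Rmult_eq_reg_r PI); lra).
    rewrite <- HJ, Rmult_assoc, Hn; ring. }
  assert (Hk1 : n = 1%Z \/ n = (-1)%Z -> k = 1 \/ k = -1).
  { intros [-> | ->]; lra. }
  (* At [PI / 2] the left side vanishes and the right side is [(D - E') * sin (k * PI) ^ 2 / 4]. If
     [D - E'] is nonzero, then [n] divides 1. *)
  destruct (Req_dec (D - E') 0) as [HDE | HDE].
  2:{ specialize (Hall' (PI / 2)).
      replace (2 * (PI / 2)) with PI in Hall' by field.
      replace (2 * (k * (PI / 2))) with (1 * (k * PI)) in Hall' by field.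
      rewrite sin_PI, cos_PI in Hall'.
      assert (Hs : (D - E') * (sin (1 * (k * PI)) ^ 2) = 0) by lra.
      destruct (Rmult_integral _ _ Hs) as [| Hs']; [easy |].
      assert (Hs2 : sin (1 * (k * PI)) = 0) by nra.
      destruct (Hsin 1%Z Hs2) as [m Hm].
      apply Hk1, (Z.mul_eq_1 n m); lia. }
  (* With both [D - E'] and [D + E'] zero the right side is identically zero, while the left side is
     positive at [PI / 4]. *)
  destruct (Req_dec (D + E') 0) as [HDE' | HDE'].
  { exfalso; specialize (Hall' (PI / 4)).
    replace E' with 0 in Hall' by lra; replace D with 0 in Hall' by lra.
    replace (2 * (PI / 4)) with (PI / 2) in Hall' by field.
    rewrite sin_PI2 in Hall'.
    generalize (COS_bound (2 * (k * (PI / 4)))).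
    set (c := cos _) in *; intros Hc.
    assert (Hpos : 0 < (al + be) / 2 + (be - al) / 2 * c) by nra.
    generalize (Rmult_lt_0_compat _ _ HQ2 Hpos); lra. }
  (* The same comparison at [PI], where the right side is [(D + E') * sin (2 * k * PI) ^ 2 / 4];
     hence [n] divides 2. *)
  assert (Hs2 : sin (2 * (k * PI)) = 0).
  { specialize (Hall' PI).
    rewrite sin_2PI, cos_2PI in Hall'.
    assert (Hs : (D + E') * (sin (2 * (k * PI)) ^ 2) = 0) by lra.
    destruct (Rmult_integral _ _ Hs) as [| Hs']; [easy |].
    nra. }
  destruct (Hsin 2%Z Hs2) as [m Hm].
  destruct (prime_divisors 2 prime_2 n) as [-> | [-> | Hn2]];
    [now exists m | apply Hk1; auto | apply Hk1; auto |].
  (* Here [k] is 1/2 or -1/2. *)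
  exfalso.
  assert (Hhalf : forall t, cos (2 * (k * t)) = cos t /\
    sin (2 * (k * t)) ^ 2 = sin t ^ 2).
  { intros t; destruct Hn2 as [-> | ->].
    - replace k with (1 / 2) by lra.
      replace (2 * (1 / 2 * t)) with t by field; auto.
    - rewrite opp_IZR in Hn; replace k with (- (1 / 2)) by lra.
      replace (2 * (- (1 / 2) * t)) with (- t) by field.
      rewrite cos_neg, sin_neg; split; [easy | ring]. }
  (* The right sides agree at [PI / 4] and [3 * PI / 4], while [cos t] changes sign on the left;
     this forces [al = be]. *)
  assert (H1 := Hall' (PI / 4)); assert (H2 := Hall' (PI - PI / 4)).
  rewrite (proj1 (Hhalf _)), (proj2 (Hhalf _)) in H1.
  rewrite (proj1 (Hhalf _)), (proj2 (Hhalf _)) in H2.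
  replace (2 * (PI / 4)) with (PI / 2) in H1 by field.
  replace (2 * (PI - PI / 4)) with (3 * (PI / 2)) in H2 by field.
  rewrite Rtrigo_facts.cos_pi_minus, Rtrigo_facts.sin_pi_minus, sin_3PI2, cos_3PI2 in H2.
  rewrite sin_PI2, cos_PI2 in H1.
  assert (Hc : 0 < cos (PI / 4)).
  { apply cos_gt_0; generalize PI_RGT_0; lra. }
  assert (Hz : Q ^ 2 * ((be - al) * cos (PI / 4)) = 0) by lra.
  destruct (Rmult_integral _ _ Hz) as [| Hz']; [lra |].
  destruct (Rmult_integral _ _ Hz'); lra.
Qed.

(** * Quadratic first integrals *)

Ltac derive_from_context :=
  auto_derive;
  [ repeat split; try lra; eexists; eassumption
  | repeat match goal with
    | H : is_derive ?f ?t ?l |- context [Derive ?g ?t] =>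
        rewrite (is_derive_unique g t l H)
    end; try (field; lra) ].

(** A sector with apex at the origin: each of its rays is whole and contains [r = 1], where radial
    integration starts. *)
Definition strip (T r t : R) : Prop := 0 < r /\ 0 < t < T.

Lemma strip_locally_r (T r t : R) :
  strip T r t -> locally r (fun x : R => strip T x t).
Proof.
  intros [Hr Ht].
  apply (filter_imp (fun x : R => 0 < x)); [now split |].
  now apply open_gt.
Qed.

Lemma strip_locally_t (T r t : R) :
  strip T r t -> locally t (fun x : R => strip T r x).
Proof.
  intros [Hr Ht].
  apply (filter_imp (fun x : R => 0 < x < T)); [now split |].
  now apply open_interval_locally.
Qed.

Lemma smooth_on_mono (D D' : R -> R -> Prop) f :
  (forall r t, D' r t -> D r t) -> smooth_on D f -> smooth_on D' f.
Proof. intros HD Hf n r t Hrt; now apply Hf, HD. Qed.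

Lemma smooth_on_Derive_r D f :
  smooth_on D f -> smooth_on D (fun r t => Derive (fun x => f x t) r).
Proof. intros Hf n r t Hrt; exact (ex_diff_n_deriv_aux1 f n r t (Hf (S n) r t Hrt)). Qed.

Lemma smooth_on_Derive_t D f :
  smooth_on D f -> smooth_on D (fun r t => Derive (fun x => f r x) t).
Proof. intros Hf n r t Hrt; exact (ex_diff_n_deriv_aux2 f n r t (Hf (S n) r t Hrt)). Qed.

Lemma smooth_on_is_derive_r D f r t :
  smooth_on D f -> D r t ->
  is_derive (fun x => f x t) r (Derive (fun x => f x t) r).
Proof. intros Hf Hrt; apply Derive_correct; exact (proj1 (proj2 (Hf 1%nat r t Hrt))). Qed.

Lemma smooth_on_is_derive_t D f r t :
  smooth_on D f -> D r t ->
  is_derive (fun x => f r x) t (Derive (fun x => f r x) t).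
Proof.
  intros Hf Hrt; apply Derive_correct.
  exact (proj1 (proj2 (proj2 (Hf 1%nat r t Hrt)))).
Qed.

(** Doubling the argument on each axis separates degree 3 from degree 1; the points [(1, 1)] and
    [(1, -1)] then separate the two mixed terms. *)
Lemma cubic_form_zero (c1 c2 c3 c4 c5 c6 : R) :
  (forall x y, c1 * x ^ 3 + c2 * (x ^ 2 * y) + c3 * (x * y ^ 2) + c4 * y ^ 3
     + c5 * x + c6 * y = 0) ->
  c1 = 0 /\ c2 = 0 /\ c3 = 0 /\ c4 = 0 /\ c5 = 0 /\ c6 = 0.
Proof.
  intros Hp.
  generalize (Hp 1 0) (Hp 2 0) (Hp 0 1) (Hp 0 2) (Hp 1 1) (Hp 1 (-1)).
  intros; repeat split; lra.
Qed.

Lemma quadratic_gradient (T : R) (F : phase_fun) (A B C U : R -> R -> R) :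
  smooth_on (strip T) A -> smooth_on (strip T) B ->
  smooth_on (strip T) C -> smooth_on (strip T) U ->
  (forall r t pr pt, strip T r t ->
     F r t pr pt =
     A r t * pr ^ 2 + 2 * B r t * (pr * pt) + C r t * pt ^ 2 + U r t) ->
  forall r t pr pt, strip T r t ->
    d_r F r t pr pt =
      Derive (fun x => A x t) r * pr ^ 2
      + 2 * Derive (fun x => B x t) r * (pr * pt)
      + Derive (fun x => C x t) r * pt ^ 2 + Derive (fun x => U x t) r /\
    d_t F r t pr pt =
      Derive (fun x => A r x) t * pr ^ 2
      + 2 * Derive (fun x => B r x) t * (pr * pt)
      + Derive (fun x => C r x) t * pt ^ 2 + Derive (fun x => U r x) t /\
    d_pr F r t pr pt = 2 * A r t * pr + 2 * B r t * pt /\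
    d_pt F r t pr pt = 2 * B r t * pr + 2 * C r t * pt.
Proof.
  intros HA HB HC HU HF r t pr pt Hrt.
  unfold d_r, d_t, d_pr, d_pt; repeat split.
  - rewrite (Derive_ext_loc _
      (fun x => A x t * pr ^ 2 + 2 * B x t * (pr * pt) + C x t * pt ^ 2 + U x t)).
    2:{ apply (filter_imp (fun x : R => strip T x t)); [| now apply strip_locally_r].
        intros x Hx; now apply HF. }
    apply is_derive_unique; auto_derive.
    + repeat split; eexists;
        eapply (smooth_on_is_derive_r (strip T)); eassumption.
    + ring.
  - rewrite (Derive_ext_loc _
      (fun x => A r x * pr ^ 2 + 2 * B r x * (pr * pt) + C r x * pt ^ 2 + U r x)).
    2:{ apply (filter_imp (fun x : R => strip T r x)); [| now apply strip_locally_t].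
        intros x Hx; now apply HF. }
    apply is_derive_unique; auto_derive.
    + repeat split; eexists;
        eapply (smooth_on_is_derive_t (strip T)); eassumption.
    + ring.
  - rewrite (Derive_ext _
      (fun x => A r t * x ^ 2 + 2 * B r t * (x * pt) + C r t * pt ^ 2 + U r t))
      by (intros x; now apply HF).
    apply is_derive_unique; auto_derive; [easy | ring].
  - rewrite (Derive_ext _
      (fun x => A r t * pr ^ 2 + 2 * B r t * (pr * x) + C r t * x ^ 2 + U r t))
      by (intros x; now apply HF).
    apply is_derive_unique; auto_derive; [easy | ring].
Qed.

(* [W1] stands for the derivative of the angular part [W]. *)
Definition has_radial_gradient (T om : R) (W W1 : R -> R) (H : phase_fun) : Prop :=
  forall r t pr pt, strip T r t ->
    d_r H r t pr pt = - 2 * pt ^ 2 / r ^ 3 - 2 * om * r - 2 * W t / r ^ 3 /\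
    d_t H r t pr pt = W1 t / r ^ 2 /\
    d_pr H r t pr pt = 2 * pr /\
    d_pt H r t pr pt = 2 * pt / r ^ 2.

(** The bracket has only terms of degree 3 and 1 in the momenta. The cubic ones give the Killing
    equations in polar coordinates, the first four below; the linear ones give the gradient of [U]
    in terms of that of the potential. *)
Lemma integral_equations (T om : R) (W W1 : R -> R) (H F : phase_fun)
    (A B C U : R -> R -> R) :
  has_radial_gradient T om W W1 H -> first_integral (strip T) H F ->
  smooth_on (strip T) A -> smooth_on (strip T) B ->
  smooth_on (strip T) C -> smooth_on (strip T) U ->
  (forall r t pr pt, strip T r t ->
     F r t pr pt =
     A r t * pr ^ 2 + 2 * B r t * (pr * pt) + C r t * pt ^ 2 + U r t) ->
  forall r t, strip T r t ->
    Derive (fun x => A x t) r = 0 /\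
    Derive (fun x => B x t) r = - Derive (fun x => A r x) t / (2 * r ^ 2) /\
    Derive (fun x => C x t) r =
      - 2 * A r t / r ^ 3 - 2 * Derive (fun x => B r x) t / r ^ 2 /\
    Derive (fun x => C r x) t = - 2 * B r t / r /\
    Derive (fun x => U x t) r =
      A r t * (- 2 * om * r - 2 * W t / r ^ 3) + B r t * W1 t / r ^ 2 /\
    Derive (fun x => U r x) t =
      r ^ 2 * B r t * (- 2 * om * r - 2 * W t / r ^ 3) + C r t * W1 t.
Proof.
  intros HH Hfi HA HB HC HU HF r t Hrt.
  assert (Hr : 0 < r) by apply Hrt.
  pose proof (quadratic_gradient T F A B C U HA HB HC HU HF) as HG.
  set (Ar := Derive (fun x => A x t) r); set (At := Derive (fun x => A r x) t).
  set (Br := Derive (fun x => B x t) r); set (Bt := Derive (fun x => B r x) t).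
  set (Cr := Derive (fun x => C x t) r); set (Ct := Derive (fun x => C r x) t).
  set (Ur := Derive (fun x => U x t) r); set (Ut := Derive (fun x => U r x) t).
  set (Vr := - 2 * om * r - 2 * W t / r ^ 3).
  destruct (cubic_form_zero
    (- 2 * Ar)
    (- 4 * Br - 2 * At / r ^ 2)
    (- 4 * A r t / r ^ 3 - 2 * Cr - 4 * Bt / r ^ 2)
    (- 4 * B r t / r ^ 3 - 2 * Ct / r ^ 2)
    (2 * A r t * Vr - 2 * Ur + 2 * B r t * W1 t / r ^ 2)
    (2 * B r t * Vr + 2 * C r t * W1 t / r ^ 2 - 2 * Ut / r ^ 2))
    as (E1 & E2 & E3 & E4 & E5 & E6).
  { intros pr pt.
    specialize (Hfi r t pr pt Hrt); unfold poisson in Hfi.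
    destruct (HH r t pr pt Hrt) as (H1 & H2 & H3 & H4).
    destruct (HG r t pr pt Hrt) as (G1 & G2 & G3 & G4).
    rewrite H1, H2, H3, H4, G1, G2, G3, G4 in Hfi.
    fold Ar At Br Bt Cr Ct Ur Ut in Hfi.
    rewrite <- Hfi; unfold Vr; field; lra. }
  assert (Hr2 : 0 < r ^ 2) by (apply pow_lt; lra).
  repeat split.
  - lra.
  - transitivity (- (1 / 4) * (- 4 * Br - 2 * At / r ^ 2) - At / (2 * r ^ 2));
      [field | rewrite E2; field]; lra.
  - transitivity (- (1 / 2) * (- 4 * A r t / r ^ 3 - 2 * Cr - 4 * Bt / r ^ 2)
      - 2 * A r t / r ^ 3 - 2 * Bt / r ^ 2);
      [field | rewrite E3; field]; lra.
  - transitivity (- (r ^ 2 / 2) * (- 4 * B r t / r ^ 3 - 2 * Ct / r ^ 2)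
      - 2 * B r t / r);
      [field | rewrite E4; field]; lra.
  - transitivity (- (1 / 2) * (2 * A r t * Vr - 2 * Ur + 2 * B r t * W1 t / r ^ 2)
      + A r t * Vr + B r t * W1 t / r ^ 2);
      [field | rewrite E5; field]; lra.
  - transitivity (- (r ^ 2 / 2) *
      (2 * B r t * Vr + 2 * C r t * W1 t / r ^ 2 - 2 * Ut / r ^ 2)
      + r ^ 2 * B r t * Vr + C r t * W1 t);
      [field | rewrite E6; field]; lra.
Qed.

Lemma radial_primitive (g G G1 : R -> R) :
  (forall r, 0 < r -> is_derive g r (G1 r)) ->
  (forall r, 0 < r -> is_derive G r (G1 r)) ->
  forall r, 0 < r -> g r = G r + (g 1 - G 1).
Proof.
  intros Hg HG r Hr.
  enough (g r - G r = g 1 - G 1) by lra.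
  apply (is_derive_zero_eq (fun x => g x - G x)).
  intros z Hz.
  assert (0 < z) by (generalize (Rmin_glb_lt r 1 0 Hr Rlt_0_1); lra).
  replace 0 with (G1 z - G1 z) by ring.
  apply (is_derive_minus (V := R_NormedModule) g G z); auto.
Qed.

(** The radial equations integrate explicitly in [r]; inserted into the angular ones, they give
    identities in [r] whose coefficients vanish separately. Here [f] is the derivative of [A] in the
    angle. Where [f] and [f1] both vanish, the differential of [F] is a combination of those of [H]
    and [pt ^ 2 + W]. *)
Lemma quadratic_integral_structure (T om : R) (W W1 W2 : R -> R) (H F : phase_fun) :
  om <> 0 ->
  (forall t, 0 < t < T -> is_derive W t (W1 t)) ->
  (forall t, 0 < t < T -> is_derive W1 t (W2 t)) ->
  has_radial_gradient T om W W1 H ->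
  quadratic_in_momenta (strip T) F -> first_integral (strip T) H F ->
  exists f f1 : R -> R, forall t, 0 < t < T ->
    is_derive f t (f1 t) /\ is_derive f1 t (- 4 * f t) /\
    f t * W2 t + 3 * f1 t * W1 t - 8 * f t * W t = 0 /\
    (f t = 0 -> f1 t = 0 -> forall r, 0 < r -> exists a c : R, forall pr pt,
       d_r F r t pr pt = a * d_r H r t pr pt /\
       d_t F r t pr pt = a * d_t H r t pr pt + c * W1 t /\
       d_pr F r t pr pt = a * d_pr H r t pr pt /\
       d_pt F r t pr pt = a * d_pt H r t pr pt + c * (2 * pt)).
Proof.
  intros Hom HW HW1 HH (A & B & C & U & HA & HB & HC & HU & HF) Hfi.
  pose proof (integral_equations T om W W1 H F A B C U HH Hfi HA HB HC HU HF)
    as HE.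
  pose proof (quadratic_gradient T F A B C U HA HB HC HU HF) as HG.
  set (a t := A 1 t).
  set (a1 t := Derive (fun x => A 1 x) t).
  set (a2 t := Derive (fun x => Derive (fun y => A 1 y) x) t).
  set (a3 t := Derive (fun z => Derive (fun x => Derive (fun y => A 1 y) x) z) t).
  assert (Ha1 : forall t, 0 < t < T -> is_derive a t (a1 t)).
  { intros t Ht; apply (smooth_on_is_derive_t (strip T)); [exact HA | split; lra]. }
  assert (Ha2 : forall t, 0 < t < T -> is_derive a1 t (a2 t)).
  { intros t Ht.
    apply (smooth_on_is_derive_t (strip T) _ 1 t (smooth_on_Derive_t _ _ HA)).
    split; lra. }
  assert (Ha3 : forall t, 0 < t < T -> is_derive a2 t (a3 t)).
  { intros t Ht.
    apply (smooth_on_is_derive_t (strip T) _ 1 t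
      (smooth_on_Derive_t _ _ (smooth_on_Derive_t _ _ HA))).
    split; lra. }
  assert (EA : forall r t, strip T r t -> A r t = a t).
  { intros r t [Hr Ht].
    rewrite (radial_primitive (fun x => A x t) (fun _ => 0) (fun _ => 0)); [| | | exact Hr].
    - unfold a; ring.
    - intros x Hx; assert (Hx' : strip T x t) by now split.
      rewrite <- (proj1 (HE x t Hx')); now apply (smooth_on_is_derive_r (strip T)).
    - intros x _; apply (is_derive_const (V := R_NormedModule)). }
  assert (EAt : forall r t, strip T r t -> Derive (fun x => A r x) t = a1 t).
  { intros r t [Hr Ht]; apply Derive_ext_loc.
    apply (filter_imp (fun x : R => 0 < x < T)); [| now apply open_interval_locally].
    intros x Hx; rewrite EA by (now split); reflexivity. }
  (* [b], and below [c] and [u], are the integration constants of the radial equations, read off at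
     [r = 1]. *)
  set (b t := B 1 t - a1 t / 2).
  set (b1 t := Derive (fun x => B 1 x) t - a2 t / 2).
  assert (Hb1 : forall t, 0 < t < T -> is_derive b t (b1 t)).
  { intros t Ht; unfold b, b1.
    pose proof (Ha2 t Ht).
    pose proof (smooth_on_is_derive_t (strip T) B 1 t HB (conj Rlt_0_1 Ht)).
    derive_from_context. }
  assert (EB : forall r t, strip T r t -> B r t = a1 t / (2 * r) + b t).
  { intros r t [Hr Ht].
    rewrite (radial_primitive (fun x => B x t) (fun x => a1 t / (2 * x))
      (fun x => - a1 t / (2 * x ^ 2))); [| | | exact Hr].
    - unfold b; field; lra.
    - intros x Hx; assert (Hx' : strip T x t) by now split.
      rewrite <- (EAt x t Hx'), <- (proj1 (proj2 (HE x t Hx'))).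
      now apply (smooth_on_is_derive_r (strip T)).
    - intros x Hx; auto_derive; [lra | field; lra]. }
  assert (EBt : forall r t, strip T r t ->
    Derive (fun x => B r x) t = a2 t / (2 * r) + b1 t).
  { intros r t [Hr Ht]; rewrite (Derive_ext_loc _ (fun x => a1 x / (2 * r) + b x)).
    2:{ apply (filter_imp (fun x : R => 0 < x < T)); [| now apply open_interval_locally].
        intros x Hx; now apply EB. }
    pose proof (Ha2 t Ht); pose proof (Hb1 t Ht).
    apply is_derive_unique; derive_from_context. }
  set (c t := C 1 t - (a t + a2 t / 2 + 2 * b1 t)).
  assert (EC : forall r t, strip T r t ->
    C r t = (a t + a2 t / 2) / r ^ 2 + 2 * b1 t / r + c t).
  { intros r t [Hr Ht].
    rewrite (radial_primitive (fun x => C x t)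
      (fun x => (a t + a2 t / 2) / x ^ 2 + 2 * b1 t / x)
      (fun x => - 2 * a t / x ^ 3 - 2 * (a2 t / (2 * x) + b1 t) / x ^ 2));
      [| | | exact Hr].
    - unfold c; field; lra.
    - intros x Hx; assert (Hx' : strip T x t) by now split.
      rewrite <- (EA x t Hx'), <- (EBt x t Hx').
      rewrite <- (proj1 (proj2 (proj2 (HE x t Hx')))).
      now apply (smooth_on_is_derive_r (strip T)).
    - intros x Hx; auto_derive; [| field; lra].
      repeat split; try lra.
      change (x * (x * 1) <> 0); apply Rgt_not_eq; nra. }
  set (u t := U 1 t - (- om * a t + a t * W t - a1 t * W1 t / 4 - b t * W1 t)).
  assert (EU : forall r t, strip T r t ->
    U r t = - om * a t * r ^ 2 + a t * W t / r ^ 2 - a1 t * W1 t / (4 * r ^ 2)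
      - b t * W1 t / r + u t).
  { intros r t [Hr Ht].
    rewrite (radial_primitive (fun x => U x t)
      (fun x => - om * a t * x ^ 2 + a t * W t / x ^ 2
         - a1 t * W1 t / (4 * x ^ 2) - b t * W1 t / x)
      (fun x => a t * (- 2 * om * x - 2 * W t / x ^ 3)
         + (a1 t / (2 * x) + b t) * W1 t / x ^ 2)); [| | | exact Hr].
    - unfold u; field; lra.
    - intros x Hx; assert (Hx' : strip T x t) by now split.
      rewrite <- (EA x t Hx'), <- (EB x t Hx').
      rewrite <- (proj1 (proj2 (proj2 (proj2 (proj2 (HE x t Hx')))))).
      now apply (smooth_on_is_derive_r (strip T)).
    - intros x Hx; assert (0 < x * (x * 1)) by nra.
      auto_derive; [| field; lra].
      repeat split; try lra. }
  pose (u1 t := Derive (fun x => U 1 x) t -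
    (- om * a1 t + (a1 t * W t + a t * W1 t) - (a2 t * W1 t + a1 t * W2 t) / 4
     - (b1 t * W1 t + b t * W2 t))).
  assert (Hu1 : forall t, 0 < t < T -> is_derive u t (u1 t)).
  { intros t Ht.
    pose proof (smooth_on_is_derive_t (strip T) U 1 t HU
      (conj Rlt_0_1 Ht)) as HU1.
    pose proof (Ha1 t Ht); pose proof (Ha2 t Ht); pose proof (Hb1 t Ht).
    pose proof (HW t Ht); pose proof (HW1 t Ht).
    unfold u, u1; derive_from_context. }
  assert (EUt : forall r t, strip T r t ->
    Derive (fun x => U r x) t =
      - om * a1 t * r ^ 2 + (a1 t * W t + a t * W1 t) / r ^ 2
      - (a2 t * W1 t + a1 t * W2 t) / (4 * r ^ 2)
      - (b1 t * W1 t + b t * W2 t) / r + u1 t).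
  { intros r t [Hr Ht].
    rewrite (Derive_ext_loc _ (fun t =>
      - om * a t * r ^ 2 + a t * W t / r ^ 2 - a1 t * W1 t / (4 * r ^ 2)
      - b t * W1 t / r + u t)).
    2:{ apply (filter_imp (fun x : R => 0 < x < T)); [| now apply open_interval_locally].
        intros x Hx; now apply EU. }
    pose proof (Ha1 t Ht); pose proof (Ha2 t Ht); pose proof (Hb1 t Ht).
    pose proof (HW t Ht); pose proof (HW1 t Ht); pose proof (Hu1 t Ht).
    apply is_derive_unique; derive_from_context. }
  (* Comparing the coefficients of the powers of [r] in [U_t]. *)
  assert (HUt : forall t, 0 < t < T ->
    om * b t = 0 /\ a1 t * W2 t + 3 * a2 t * W1 t - 8 * a1 t * W t = 0).
  { intros t Ht.
    assert (Eq : forall r, 0 < r ->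
      - 2 * (om * b t) * r ^ 5
      + (- 2 * b t * W t + 2 * b1 t * W1 t + b1 t * W1 t + b t * W2 t) * r
      + (c t * W1 t - u1 t) * r ^ 2
      + (- 2 * a1 t * W t + 3 / 4 * (a2 t * W1 t) + a1 t * W2 t / 4) = 0).
    { intros r Hr; assert (Hrt : strip T r t) by now split.
      pose proof (proj2 (proj2 (proj2 (proj2 (proj2 (HE r t Hrt)))))) as E.
      rewrite (EUt r t Hrt), (EB r t Hrt), (EC r t Hrt) in E.
      apply (Rmult_eq_compat_r (r ^ 2)) in E.
      apply Rminus_diag_eq, Ropp_eq_0_compat in E.
      etransitivity; [| exact E]; field; lra. }
    (* Four coefficients, of the powers 5, 1, 2 and 0, are determined by four positive values of
       [r]. *)
    pose proof (Eq 1 ltac:(lra)); pose proof (Eq 2 ltac:(lra)).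
    pose proof (Eq 3 ltac:(lra)); pose proof (Eq 4 ltac:(lra)).
    split; lra. }
  assert (Eb : forall t, 0 < t < T -> b t = 0).
  { intros t Ht; destruct (Rmult_integral _ _ (proj1 (HUt t Ht))); easy. }
  assert (Eb1 : forall t, 0 < t < T -> b1 t = 0).
  { intros t Ht; apply (is_derive_eq_interval b (fun _ => 0) 0 T t);
      [exact Eb | exact Ht | now apply Hb1
      | apply (is_derive_const (V := R_NormedModule))]. }
  (* With [b = 0], the coefficient of [1 / r ^ 2] in the angular equation for [C] reads
     [a' + a''' / 2 = - a']. *)
  assert (Ea3 : forall t, 0 < t < T -> a3 t = - 4 * a1 t).
  { intros t Ht.
    pose (c1 := Derive (fun x => C 1 x) t - (a1 t + a3 t / 2)).
    assert (Hc1 : is_derive (fun t => C 1 t - (a t + a2 t / 2)) t c1).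
    { unfold c1.
      pose proof (smooth_on_is_derive_t (strip T) C 1 t HC (conj Rlt_0_1 Ht)).
      pose proof (Ha1 t Ht); pose proof (Ha3 t Ht).
      derive_from_context. }
    assert (Eq : forall r, 0 < r -> (a1 t + a3 t / 2) / r ^ 2 + c1 = - a1 t / r ^ 2).
    { intros r Hr; assert (Hrt : strip T r t) by now split.
      pose proof (proj1 (proj2 (proj2 (proj2 (HE r t Hrt))))) as E.
      rewrite (EB r t Hrt), (Eb t Ht) in E.
      replace (- a1 t / r ^ 2) with (- 2 * (a1 t / (2 * r) + 0) / r)
        by (field; lra).
      rewrite <- E; symmetry; apply is_derive_unique.
      apply (is_derive_ext_loc (fun t =>
        (a t + a2 t / 2) / r ^ 2 + (C 1 t - (a t + a2 t / 2)))).
      { apply (filter_imp (fun x : R => 0 < x < T)); [| now apply open_interval_locally].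
        intros x Hx; symmetry; rewrite (EC r x) by (now split).
        unfold c; rewrite (Eb1 x Hx).
        match goal with |- ?x = ?y => change (@eq R x y) end; field; lra. }
      apply (is_derive_plus (V := R_NormedModule)); [| exact Hc1].
      pose proof (Ha1 t Ht); pose proof (Ha3 t Ht).
      derive_from_context. }
    pose proof (Eq 1 ltac:(lra)); pose proof (Eq 2 ltac:(lra)); lra. }
  exists a1, a2; intros t Ht.
  split; [now apply Ha2 |].
  split; [rewrite <- (Ea3 t Ht); now apply Ha3 |].
  split; [now apply HUt |].
  intros Hz1 Hz2 r Hr; assert (Hrt : strip T r t) by now split.
  exists (a t), (c t); intros pr pt.
  destruct (HG r t pr pt Hrt) as (-> & -> & -> & ->).
  destruct (HH r t pr pt Hrt) as (-> & -> & -> & ->).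
  destruct (HE r t Hrt) as (-> & -> & -> & -> & -> & ->).
  rewrite (EBt r t Hrt), (EAt r t Hrt), (EB r t Hrt), (EA r t Hrt), (EC r t Hrt).
  rewrite (Eb t Ht), (Eb1 t Ht), Hz1, Hz2.
  repeat split; field; lra.
Qed.

(** * Multi-separability forces k = 1 or k = -1 *)

(** The [W] in the form [- om * r ^ 2 + W t / r ^ 2] of the potential. *)
Definition ttw_angular (k al be t : R) : R :=
  al / cos (k * t) ^ 2 + be / sin (k * t) ^ 2.

Definition ttw_angular_deriv (k al be t : R) : R :=
  2 * k * (al * sin (k * t) / cos (k * t) ^ 3 - be * cos (k * t) / sin (k * t) ^ 3).

Definition ttw_angular_deriv2 (k al be t : R) : R :=
  2 * k ^ 2 * (al / cos (k * t) ^ 2 + 3 * al * sin (k * t) ^ 2 / cos (k * t) ^ 4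
    + be / sin (k * t) ^ 2 + 3 * be * cos (k * t) ^ 2 / sin (k * t) ^ 4).

Lemma is_derive_ttw_angular k al be t :
  cos (k * t) <> 0 -> sin (k * t) <> 0 ->
  is_derive (ttw_angular k al be) t (ttw_angular_deriv k al be t).
Proof.
  intros Hc Hs; unfold ttw_angular, ttw_angular_deriv.
  auto_derive; [| field; auto].
  repeat split; repeat apply Rmult_integral_contrapositive_currified; auto; lra.
Qed.

Lemma is_derive_ttw_angular_deriv k al be t :
  cos (k * t) <> 0 -> sin (k * t) <> 0 ->
  is_derive (ttw_angular_deriv k al be) t (ttw_angular_deriv2 k al be t).
Proof.
  intros Hc Hs; unfold ttw_angular_deriv, ttw_angular_deriv2.
  auto_derive; [| field; auto].
  repeat split; repeat apply Rmult_integral_contrapositive_currified; auto; lra.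
Qed.

Lemma ttw_hamiltonian_gradient k om al be r t pr pt :
  ttw_region k r t ->
  let H := natural_hamiltonian (ttw_potential k om al be) in
  d_r H r t pr pt =
    - 2 * pt ^ 2 / r ^ 3 - 2 * om * r - 2 * ttw_angular k al be t / r ^ 3 /\
  d_t H r t pr pt = ttw_angular_deriv k al be t / r ^ 2 /\
  d_pr H r t pr pt = 2 * pr /\
  d_pt H r t pr pt = 2 * pt / r ^ 2.
Proof.
  intros (Hr & _ & Hc & Hs) H; unfold H; clear H.
  unfold d_r, d_t, d_pr, d_pt, natural_hamiltonian, ttw_potential,
    ttw_angular, ttw_angular_deriv.
  repeat split; apply is_derive_unique; auto_derive;
    try (field; repeat split; auto; lra);
    repeat split; repeat apply Rmult_integral_contrapositive_currified; auto; lra.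
Qed.

(** For [T] the smaller of [2 * PI] and [PI / (2 * |k|)], the angle [|k| * t] stays in the open
    first quadrant. *)
Lemma strip_ttw_region (k : R) :
  k <> 0 -> exists T, 0 < T /\ forall r t, strip T r t -> ttw_region k r t.
Proof.
  intros Hk.
  assert (Hk' : 0 < Rabs k) by now apply Rabs_pos_lt.
  assert (HPI := PI_RGT_0).
  set (M := PI / 2 / Rabs k).
  assert (HM : 0 < M) by (unfold M; apply Rdiv_lt_0_compat; lra).
  exists (Rmin (2 * PI) M); split; [apply Rmin_glb_lt; lra |].
  intros r t [Hr Ht].
  generalize (Rmin_l (2 * PI) M) (Rmin_r (2 * PI) M); intros H1 H2.
  assert (Hkt : 0 < Rabs k * t < PI / 2).
  { split; [apply Rmult_lt_0_compat; lra |].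
    replace (PI / 2) with (Rabs k * M) by (unfold M; field; lra).
    apply Rmult_lt_compat_l; lra. }
  assert (Hc : 0 < cos (Rabs k * t)) by (apply cos_gt_0; lra).
  assert (Hs : 0 < sin (Rabs k * t)) by (apply sin_gt_0; lra).
  repeat split; try lra.
  - revert Hc; unfold Rabs; destruct (Rcase_abs k); [| lra].
    rewrite Ropp_mult_distr_l_reverse, cos_neg; lra.
  - revert Hs; unfold Rabs; destruct (Rcase_abs k); [| lra].
    rewrite Ropp_mult_distr_l_reverse, sin_neg; lra.
Qed.

(** Two integrations solve the equation for [W]: with [f'' = - 4 * f], its left side is the
    derivative of [f * W' + 2 * f' * W], and [f] times the latter is the derivative of
    [f ^ 2 * W]. *)
Lemma ttw_angular_equation (k al be T : R) (f f1 : R -> R) :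
  k <> 0 -> 0 < al -> 0 < be -> al <> be ->
  (forall r t, strip T r t -> ttw_region k r t) ->
  (forall t, 0 < t < T -> is_derive f t (f1 t)) ->
  (forall t, 0 < t < T -> is_derive f1 t (- 4 * f t)) ->
  (forall t, 0 < t < T ->
     f t * ttw_angular_deriv2 k al be t + 3 * f1 t * ttw_angular_deriv k al be t
       - 8 * f t * ttw_angular k al be t = 0) ->
  (exists t, 0 < t < T /\ (f t <> 0 \/ f1 t <> 0)) ->
  k = 1 \/ k = -1.
Proof.
  intros Hk Hal Hbe Hab Hreg Hf Hf1 Hode (t0 & Ht0 & Hnz).
  set (W := ttw_angular k al be) in *.
  set (W1 := ttw_angular_deriv k al be) in *.
  set (W2 := ttw_angular_deriv2 k al be) in *.
  assert (Hcs : forall t, 0 < t < T -> cos (k * t) <> 0 /\ sin (k * t) <> 0).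
  { intros t Ht; apply (Hreg 1 t); now split; [lra |]. }
  assert (HW : forall t, 0 < t < T -> is_derive W t (W1 t)).
  { intros t Ht; apply is_derive_ttw_angular; now apply Hcs. }
  assert (HW1 : forall t, 0 < t < T -> is_derive W1 t (W2 t)).
  { intros t Ht; apply is_derive_ttw_angular_deriv; now apply Hcs. }
  assert (Hconst : forall g : R -> R, (forall t, 0 < t < T -> is_derive g t 0) ->
    forall t, 0 < t < T -> g t = g t0).
  { intros g Hg t Ht; apply is_derive_zero_eq; intros z; unfold Rmin, Rmax.
    destruct (Rle_dec t t0); intros Hz; apply Hg; lra. }
  (* Chosen so that [P cos 2t + Q sin 2t] has the value and the derivative of [f] at [t0];
     uniqueness for the oscillator makes them equal. *)
  set (P := f t0 * cos (2 * t0) - f1 t0 / 2 * sin (2 * t0)).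
  set (Q := f t0 * sin (2 * t0) + f1 t0 / 2 * cos (2 * t0)).
  assert (Hsc := sin2_cos2 (2 * t0)); unfold Rsqr in Hsc.
  assert (EP : P * cos (2 * t0) + Q * sin (2 * t0) = f t0).
  { transitivity (f t0 * (sin (2 * t0) * sin (2 * t0) + cos (2 * t0) * cos (2 * t0)));
      [unfold P, Q; ring | rewrite Hsc; ring]. }
  assert (EQ : 2 * (Q * cos (2 * t0) - P * sin (2 * t0)) = f1 t0).
  { transitivity (f1 t0 * (sin (2 * t0) * sin (2 * t0) + cos (2 * t0) * cos (2 * t0)));
      [unfold P, Q; field | rewrite Hsc; ring]. }
  assert (HPQ : P <> 0 \/ Q <> 0).
  { destruct (Req_dec P 0) as [HP | HP]; [right | now left].
    intros HQ; rewrite HP, HQ in EP, EQ; destruct Hnz as [Hn | Hn]; lra. }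
  assert (Ef : forall t, 0 < t < T -> f t = P * cos (2 * t) + Q * sin (2 * t)).
  { intros t Ht; apply Rminus_diag_uniq; revert t Ht.
    apply (harmonic_oscillator_zero
      (fun t => f t - (P * cos (2 * t) + Q * sin (2 * t)))
      (fun t => f1 t - 2 * (Q * cos (2 * t) - P * sin (2 * t))) 2 0 T t0).
    - intros t Ht; pose proof (Hf t Ht); derive_from_context.
    - intros t Ht; pose proof (Hf1 t Ht); derive_from_context.
    - exact Ht0.
    - lra.
    - lra. }
  (* [f * W' + 2 * f' * W] is a first integral of the equation for [W]. *)
  set (C1 := f t0 * W1 t0 + 2 * f1 t0 * W t0).
  assert (HC1 : forall t, 0 < t < T -> f t * W1 t + 2 * f1 t * W t = C1).
  { apply (Hconst (fun t => f t * W1 t + 2 * f1 t * W t)).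
    intros t Ht; pose proof (Hf t Ht); pose proof (Hf1 t Ht).
    pose proof (HW t Ht); pose proof (HW1 t Ht).
    derive_from_context; rewrite <- (Hode t Ht); ring. }
  (* The derivative of [f ^ 2 * W] is [C1 * f], and the bracketed sum is twice a primitive of [f],
     hence the factor 1/2. *)
  set (G t := f t ^ 2 * W t - C1 / 2 * (P * sin (2 * t) - Q * cos (2 * t))).
  assert (HG : forall t, 0 < t < T -> G t = G t0).
  { apply Hconst.
    intros t Ht; pose proof (Hf t Ht); pose proof (HW t Ht).
    unfold G; derive_from_context.
    replace 0 with (f t * (f t * W1 t + 2 * f1 t * W t) - C1 * f t)
      by (rewrite (HC1 t Ht); ring).
    rewrite (Ef t Ht) at 6; field. }
  apply (angular_identity_exponent k al be T P Q (C1 / 2) (G t0)); auto.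
  { lra. }
  intros t Ht; destruct (Hcs t Ht) as [Hc Hs].
  rewrite <- (HG t Ht); unfold G; rewrite (Ef t Ht).
  unfold W, ttw_angular; field; auto.
Qed.

(** For other [k], the angular equation leaves only [f = 0]. The differentials of [H], [F1] and [F2]
    then lie in the span of two covectors all over the strip, against independence on a dense
    set. *)
Lemma ttw_superintegrable_exponent (k om al be : R) :
  k <> 0 -> om <> 0 -> 0 < al -> 0 < be -> al <> be ->
  multiseparable_superintegrable (ttw_region k) (ttw_potential k om al be) ->
  k = 1 \/ k = -1.
Proof.
  intros Hk Hom Hal Hbe Hab (F1 & F2 & HF1 & HF2 & Hi1 & Hi2 & Hind).
  set (H := natural_hamiltonian (ttw_potential k om al be)) in *.
  set (W := ttw_angular k al be); set (W1 := ttw_angular_deriv k al be).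
  set (W2 := ttw_angular_deriv2 k al be).
  destruct (strip_ttw_region k Hk) as (T & HT & Hreg).
  assert (Hcs : forall t, 0 < t < T -> cos (k * t) <> 0 /\ sin (k * t) <> 0).
  { intros t Ht; apply (Hreg 1 t); now split; [lra |]. }
  assert (Hstr : forall F, quadratic_in_momenta (ttw_region k) F ->
    first_integral (ttw_region k) H F ->
    ~ (k = 1 \/ k = -1) ->
    forall r t, strip T r t -> exists a c : R, forall pr pt,
       d_r F r t pr pt = a * d_r H r t pr pt /\
       d_t F r t pr pt = a * d_t H r t pr pt + c * W1 t /\
       d_pr F r t pr pt = a * d_pr H r t pr pt /\
       d_pt F r t pr pt = a * d_pt H r t pr pt + c * (2 * pt)).
  { intros F (A & B & C & U & HA & HB & HC & HU & HF) HFi Hk1 r t [Hr Ht].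
    destruct (quadratic_integral_structure T om W W1 W2 H F) as (f & f1 & Hff).
    - exact Hom.
    - intros; apply is_derive_ttw_angular; now apply Hcs.
    - intros; apply is_derive_ttw_angular_deriv; now apply Hcs.
    - intros r' t' pr pt Hrt; apply ttw_hamiltonian_gradient; auto.
    - exists A, B, C, U.
      repeat split; try (apply (smooth_on_mono (ttw_region k)); auto).
      intros; apply HF; auto.
    - intros r' t' pr pt Hrt; apply HFi; auto.
    - destruct (Hff t Ht) as (_ & _ & _ & Hdep).
      apply Hdep; [| | exact Hr]; apply NNPP; intros Hne; apply Hk1;
        (apply (ttw_angular_equation k al be T f f1); auto;
          [ intros; now apply Hff .. | exists t; auto ]). }
  apply NNPP; intros Hk1.
  assert (Hreg1 : ttw_region k 1 (T / 2)) by (apply Hreg; split; lra).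
  (* This radius keeps the nearby point inside the strip. *)
  destruct (Hind 1 (T / 2) 0 0 (Rmin 1 (T / 2)) Hreg1)
    as (r & t & pr & pt & _ & Hr & Ht & _ & _ & Hi).
  { apply Rmin_glb_lt; lra. }
  assert (Hrt : strip T r t).
  { generalize (Rmin_l 1 (T / 2)) (Rmin_r 1 (T / 2)); intros.
    apply Rabs_def2 in Hr; apply Rabs_def2 in Ht; split; lra. }
  destruct (Hstr F1 HF1 Hi1 Hk1 r t Hrt) as (a1 & c1 & HD1).
  destruct (Hstr F2 HF2 Hi2 Hk1 r t Hrt) as (a2 & c2 & HD2).
  specialize (HD1 pr pt); specialize (HD2 pr pt).
  destruct HD1 as (R1 & T1 & PR1 & PT1), HD2 as (R2 & T2 & PR2 & PT2).
  unfold differentials_independent in Hi.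
  rewrite R1, T1, PR1, PT1, R2, T2, PR2, PT2 in Hi.
  (* From [dF1 = a1 dH + c1 dG] and [dF2 = a2 dH + c2 dG], with [G = pt ^ 2 + W], this combination
     eliminates [dG]. It gives [c1 = c2 = 0], after which [dF1 = a1 dH] is itself a forbidden
     relation. *)
  destruct (Hi (- (c2 * a1 - c1 * a2)) c2 (- c1)) as (_ & Hc2 & Hc1); try ring.
  destruct (Hi (- a1) 1 0) as (_ & H1 & _); try lra.
  - replace c1 with 0 by lra; ring.
  - replace c1 with 0 by lra; ring.
Qed.

(** * Smoothness *)

(* A syntactic class closed under both partial derivatives, so that smoothness
   follows by induction on the order of differentiation. *)
Inductive elem : Type :=
  | Cst (c : R) | Rad | RadInv | Cos | Sin | CosInv | SinInv
  | Plus (e1 e2 : elem) | Mult (e1 e2 : elem).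

Fixpoint eval (k : R) (e : elem) (r t : R) : R :=
  match e with
  | Cst c => c
  | Rad => r
  | RadInv => / r
  | Cos => cos (k * t)
  | Sin => sin (k * t)
  | CosInv => / cos (k * t)
  | SinInv => / sin (k * t)
  | Plus e1 e2 => eval k e1 r t + eval k e2 r t
  | Mult e1 e2 => eval k e1 r t * eval k e2 r t
  end.

Fixpoint elem_dr (e : elem) : elem :=
  match e with
  | Rad => Cst 1
  | RadInv => Mult (Cst (-1)) (Mult RadInv RadInv)
  | Plus e1 e2 => Plus (elem_dr e1) (elem_dr e2)
  | Mult e1 e2 => Plus (Mult (elem_dr e1) e2) (Mult e1 (elem_dr e2))
  | _ => Cst 0
  end.

Fixpoint elem_dt (k : R) (e : elem) : elem :=
  match e with
  | Cos => Mult (Cst (- k)) Sin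
  | Sin => Mult (Cst k) Cos
  | CosInv => Mult (Cst k) (Mult Sin (Mult CosInv CosInv))
  | SinInv => Mult (Cst (- k)) (Mult Cos (Mult SinInv SinInv))
  | Plus e1 e2 => Plus (elem_dt k e1) (elem_dt k e2)
  | Mult e1 e2 => Plus (Mult (elem_dt k e1) e2) (Mult e1 (elem_dt k e2))
  | _ => Cst 0
  end.

Lemma is_derive_eval_r k e r t :
  ttw_region k r t -> is_derive (fun x => eval k e x t) r (eval k (elem_dr e) r t).
Proof.
  intros (Hr & _ & Hc & Hs).
  induction e; simpl; try (auto_derive; [lra | field; lra]).
  - apply (is_derive_plus (V := R_NormedModule) (fun x => eval k e1 x t)
      (fun x => eval k e2 x t)); assumption.
  - apply (is_derive_mult (fun x => eval k e1 x t) (fun x => eval k e2 x t));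
      try assumption; apply Rmult_comm.
Qed.

Lemma is_derive_eval_t k e r t :
  ttw_region k r t ->
  is_derive (fun x => eval k e r x) t (eval k (elem_dt k e) r t).
Proof.
  intros (Hr & _ & Hc & Hs).
  induction e; simpl; try (auto_derive; [easy | field; easy]).
  - apply (is_derive_plus (V := R_NormedModule) (fun x => eval k e1 r x)
      (fun x => eval k e2 r x)); assumption.
  - apply (is_derive_mult (fun x => eval k e1 r x) (fun x => eval k e2 r x));
      try assumption; apply Rmult_comm.
Qed.

Lemma continuity_2d_pt_trig (f : R -> R) k r t :
  continuity f -> continuity_2d_pt (fun _ y => f (k * y)) r t.
Proof.
  intros Hf; apply (continuity_1d_2d_pt_comp f (fun _ y => k * y)).
  - apply Hf.
  - apply continuity_2d_pt_mult;
      [apply continuity_2d_pt_const | apply continuity_2d_pt_id2].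
Qed.

Lemma continuity_2d_pt_eval k e r t :
  ttw_region k r t -> continuity_2d_pt (eval k e) r t.
Proof.
  intros (Hr & _ & Hc & Hs).
  induction e; simpl.
  - apply continuity_2d_pt_const.
  - apply continuity_2d_pt_id1.
  - apply (continuity_2d_pt_inv (fun x _ => x));
      [apply continuity_2d_pt_id1 | lra].
  - apply continuity_2d_pt_trig, continuity_cos.
  - apply continuity_2d_pt_trig, continuity_sin.
  - apply (continuity_2d_pt_inv (fun _ y => cos (k * y)));
      [apply continuity_2d_pt_trig, continuity_cos | exact Hc].
  - apply (continuity_2d_pt_inv (fun _ y => sin (k * y)));
      [apply continuity_2d_pt_trig, continuity_sin | exact Hs].
  - now apply (continuity_2d_pt_plus (eval k e1) (eval k e2)).
  - now apply (continuity_2d_pt_mult (eval k e1) (eval k e2)).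
Qed.

Lemma ttw_region_open k r t :
  ttw_region k r t -> locally_2d (ttw_region k) r t.
Proof.
  intros (Hr & Ht & Hc & Hs).
  assert (Hpos : locally_2d (fun x y => 0 < x /\ 0 < y < 2 * PI) r t).
  { set (d := Rmin r (Rmin t (2 * PI - t))).
    assert (Hd : 0 < d) by (repeat apply Rmin_glb_lt; lra).
    exists (mkposreal d Hd); simpl; intros x y Hx Hy.
    apply Rabs_def2 in Hx; apply Rabs_def2 in Hy.
    generalize (Rmin_l r (Rmin t (2 * PI - t))) (Rmin_r r (Rmin t (2 * PI - t)))
      (Rmin_l t (2 * PI - t)) (Rmin_r t (2 * PI - t)); fold d; lra. }
  assert (Hcos : locally_2d (fun _ y => cos (k * y) <> 0) r t).
  { apply (continuity_2d_pt_neq_0 (fun _ y => cos (k * y))); [| exact Hc].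
    apply continuity_2d_pt_trig, continuity_cos. }
  assert (Hsin : locally_2d (fun _ y => sin (k * y) <> 0) r t).
  { apply (continuity_2d_pt_neq_0 (fun _ y => sin (k * y))); [| exact Hs].
    apply continuity_2d_pt_trig, continuity_sin. }
  generalize (locally_2d_and _ _ _ _ Hpos (locally_2d_and _ _ _ _ Hcos Hsin)).
  apply locally_2d_impl, locally_2d_forall; unfold ttw_region; tauto.
Qed.

(** The partial derivatives agree with their syntactic counterparts only on the region; its openness
    makes the agreement local, as the induction requires. *)
Lemma smooth_on_eval k e f :
  (forall r t, ttw_region k r t -> f r t = eval k e r t) ->
  smooth_on (ttw_region k) f.
Proof.
  intros Hf n r t Hrt.
  apply (ex_diff_n_ext_loc (eval k e)).
  { generalize (ttw_region_open k r t Hrt).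
    apply locally_2d_impl, locally_2d_forall; intros x y Hxy; symmetry; auto. }
  clear f Hf; revert e r t Hrt.
  induction n as [| n IH]; intros e r t Hrt; simpl.
  { split; [now apply continuity_2d_pt_eval | easy]. }
  split; [now apply continuity_2d_pt_eval |].
  split; [eexists; now apply is_derive_eval_r |].
  split; [eexists; now apply is_derive_eval_t |].
  assert (Hloc := ttw_region_open k r t Hrt).
  split.
  - apply (ex_diff_n_ext_loc (eval k (elem_dr e))); [| now apply IH].
    revert Hloc; apply locally_2d_impl, locally_2d_forall; intros x y Hxy.
    symmetry; now apply is_derive_unique, is_derive_eval_r.
  - apply (ex_diff_n_ext_loc (eval k (elem_dt k e))); [| now apply IH].
    revert Hloc; apply locally_2d_impl, locally_2d_forall; intros x y Hxy.
    symmetry; now apply is_derive_unique, is_derive_eval_t.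
Qed.

(** * The integrals for k = 1 and k = -1 *)

(** [pt ^ 2 + W], the integral from separation in polar coordinates, conserved for every [k]. *)
Definition angular_integral (k al be : R) : phase_fun :=
  fun r t pr pt => pt ^ 2 + al / cos (k * t) ^ 2 + be / sin (k * t) ^ 2.

(* For [k = 1] or [k = -1] this is [p_x ^ 2 - om * x ^ 2 + al / x ^ 2]. *)
Definition cartesian_integral (k om al : R) : phase_fun :=
  fun r t pr pt =>
    (cos (k * t) * pr - k * sin (k * t) / r * pt) ^ 2
    - om * r ^ 2 * cos (k * t) ^ 2 + al / (r ^ 2 * cos (k * t) ^ 2).

Lemma angular_integral_gradient k al be r t pr pt :
  ttw_region k r t ->
  let F := angular_integral k al be in
  d_r F r t pr pt = 0 /\
  d_t F r t pr pt = ttw_angular_deriv k al be t /\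
  d_pr F r t pr pt = 0 /\
  d_pt F r t pr pt = 2 * pt.
Proof.
  intros (Hr & _ & Hc & Hs) F; unfold F; clear F.
  unfold d_r, d_t, d_pr, d_pt, angular_integral, ttw_angular_deriv.
  repeat split; apply is_derive_unique; auto_derive;
    try (field; repeat split; auto; lra);
    repeat split; repeat apply Rmult_integral_contrapositive_currified; auto; lra.
Qed.

Lemma cartesian_integral_gradient k om al r t pr pt :
  ttw_region k r t ->
  let F := cartesian_integral k om al in
  let c := cos (k * t) in let s := sin (k * t) in
  let p := c * pr - k * s / r * pt in
  d_r F r t pr pt =
    2 * p * k * s * pt / r ^ 2 - 2 * om * r * c ^ 2 - 2 * al / (r ^ 3 * c ^ 2) /\
  d_t F r t pr pt =
    2 * p * (- k * s * pr - k ^ 2 * c / r * pt) + 2 * k * om * r ^ 2 * c * s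
    + 2 * k * al * s / (r ^ 2 * c ^ 3) /\
  d_pr F r t pr pt = 2 * p * c /\
  d_pt F r t pr pt = - 2 * p * k * s / r.
Proof.
  intros (Hr & _ & Hc & Hs) F c s p; unfold F, p, c, s; clear F p c s.
  unfold d_r, d_t, d_pr, d_pt, cartesian_integral.
  repeat split; apply is_derive_unique; auto_derive;
    try (field; repeat split; auto; lra);
    repeat split; repeat apply Rmult_integral_contrapositive_currified; auto; lra.
Qed.

Lemma angular_integral_first_integral k om al be :
  first_integral (ttw_region k)
    (natural_hamiltonian (ttw_potential k om al be)) (angular_integral k al be).
Proof.
  intros r t pr pt Hrt; unfold poisson.
  destruct (ttw_hamiltonian_gradient k om al be r t pr pt Hrt)
    as (-> & -> & -> & ->).
  destruct (angular_integral_gradient k al be r t pr pt Hrt)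
    as (-> & -> & -> & ->).
  field; apply Rgt_not_eq, Hrt.
Qed.

Lemma cartesian_integral_first_integral k om al be :
  k = 1 \/ k = -1 ->
  first_integral (ttw_region k)
    (natural_hamiltonian (ttw_potential k om al be)) (cartesian_integral k om al).
Proof.
  intros Hk r t pr pt Hrt; unfold poisson.
  destruct (ttw_hamiltonian_gradient k om al be r t pr pt Hrt)
    as (-> & -> & -> & ->).
  destruct (cartesian_integral_gradient k om al r t pr pt Hrt)
    as (-> & -> & -> & ->).
  destruct Hrt as (Hr & _ & Hc & Hs).
  assert (Hsc := sin2_cos2 (k * t)); unfold Rsqr in Hsc.
  unfold ttw_angular, ttw_angular_deriv.
  set (c := cos (k * t)) in *; set (s := sin (k * t)) in *; clearbody c s.
  (* The bracket vanishes as a rational identity in [c] and [s] modulo this relation. *)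
  assert (Hs2 : s ^ 2 = 1 - c ^ 2) by lra.
  destruct Hk as [-> | ->]; field [Hs2]; repeat split; auto; lra.
Qed.

(** * Functional independence of the three integrals *)

(** A genuine cubic cannot vanish at four equally spaced points. The factor [y] makes the point
    found nonzero as well. *)
Lemma cubic_nonzero_near (q3 q2 q1 x eps : R) :
  q3 <> 0 -> 0 < eps ->
  exists y, Rabs (y - x) < eps /\ y * (q3 * y ^ 2 + q2 * y + q1) <> 0.
Proof.
  intros Hq Heps.
  set (q y := y * (q3 * y ^ 2 + q2 * y + q1)).
  set (d := eps / 4).
  assert (Hd : 0 < d) by (unfold d; lra).
  assert (Hnear : forall i, 0 <= i <= 3 -> Rabs (x + i * d - x) < eps).
  { intros i Hi; replace (x + i * d - x) with (i * d) by ring.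
    rewrite Rabs_pos_eq by nra; unfold d; nra. }
  destruct (Req_dec (q (x + 0 * d)) 0) as [Z0 | N0];
    [| exists (x + 0 * d); split; [apply Hnear; lra | exact N0]].
  destruct (Req_dec (q (x + 1 * d)) 0) as [Z1 | N1];
    [| exists (x + 1 * d); split; [apply Hnear; lra | exact N1]].
  destruct (Req_dec (q (x + 2 * d)) 0) as [Z2 | N2];
    [| exists (x + 2 * d); split; [apply Hnear; lra | exact N2]].
  exists (x + 3 * d); split; [apply Hnear; lra |].
  intros Z3; change (q (x + 3 * d) = 0) in Z3.
  (* third finite difference *)
  assert (Hdiff : q3 * (6 * d ^ 3) = 0).
  { transitivity (q (x + 3 * d) - 3 * q (x + 2 * d) + 3 * q (x + 1 * d)
      - q (x + 0 * d)); [unfold q; ring |].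
    rewrite Z0, Z1, Z2, Z3; ring. }
  destruct (Rmult_integral _ _ Hdiff) as [| Hz]; [easy |].
  assert (0 < d ^ 3) by (apply pow_lt; exact Hd); lra.
Qed.

(** The angular integral has no [r] and [pr] derivatives, so these two rows involve only [H] and
    [F]; the hypothesis is half their minor and gives [c = 0]. Then [pr <> 0] gives [a = 0], and
    [pt <> 0] gives [b = 0]. *)
Lemma integrals_independent_at k om al be r t pr pt :
  ttw_region k r t -> pr <> 0 -> pt <> 0 ->
  let H := natural_hamiltonian (ttw_potential k om al be) in
  let F := cartesian_integral k om al in
  pr * d_r F r t pr pt
    - cos (k * t) * (cos (k * t) * pr - k * sin (k * t) / r * pt)
      * d_r H r t pr pt <> 0 ->
  differentials_independent H (angular_integral k al be) F r t pr pt.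
Proof.
  intros Hrt Hpr Hpt H F Hdet a b c E1 E2 E3 E4.
  assert (Hr : 0 < r) by apply Hrt.
  destruct (ttw_hamiltonian_gradient k om al be r t pr pt Hrt)
    as (_ & _ & H3 & H4); fold H in H3, H4.
  destruct (angular_integral_gradient k al be r t pr pt Hrt)
    as (A1 & _ & A3 & A4).
  destruct (cartesian_integral_gradient k om al r t pr pt Hrt)
    as (_ & _ & C3 & C4); fold F in C3, C4.
  rewrite A1 in E1; rewrite H3, A3, C3 in E3; rewrite H4, A4, C4 in E4.
  clear H3 H4 A1 A3 A4 C3 C4.
  set (p := cos (k * t) * pr - k * sin (k * t) / r * pt) in *.
  assert (Hc : c = 0).
  { apply (Rmult_eq_reg_r _ _ _) with (2 := Hdet).
    transitivity (pr * (a * d_r H r t pr pt + b * 0 + c * d_r F r t pr pt)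
      - 1 / 2 * d_r H r t pr pt
        * (a * (2 * pr) + b * 0 + c * (2 * p * cos (k * t)))); [field |].
    rewrite E1, E3; ring. }
  subst c.
  assert (Ha : a = 0) by (apply (Rmult_eq_reg_r pr); lra).
  subst a.
  repeat split; apply (Rmult_eq_reg_r pt); lra.
Qed.

Lemma integrals_functionally_independent k om al be :
  k = 1 \/ k = -1 ->
  functionally_independent (ttw_region k)
    (natural_hamiltonian (ttw_potential k om al be))
    (angular_integral k al be) (cartesian_integral k om al).
Proof.
  intros Hk r t pr pt eps Hrt Heps.
  (* Only the momenta are moved: first [pt] off zero, then [pr] off the zeros of the minor. *)
  assert (Hpt : exists pt', Rabs (pt' - pt) < eps /\ pt' <> 0).
  { destruct (Req_dec pt 0) as [-> | Hn].
    - exists (eps / 2); rewrite Rabs_pos_eq; lra.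
    - exists pt; split; [| exact Hn].
      replace (pt - pt) with 0 by ring; rewrite Rabs_R0; lra. }
  destruct Hpt as (pt' & Hpt & Hpt0).
  set (c := cos (k * t)); set (m := k * sin (k * t) / r * pt').
  set (X := - 2 * om * r * c ^ 2 - 2 * al / (r ^ 3 * c ^ 2)).
  set (Y := - 2 * pt' ^ 2 / r ^ 3 - 2 * om * r - 2 * ttw_angular k al be t / r ^ 3).
  assert (Hrt' := Hrt); destruct Hrt' as (Hr & _ & Hc & Hs).
  (* These are the coefficients of the minor as a quadratic in [pr']; the leading one is nonzero
     because [k], [cos (k * t)], [sin (k * t)] and [pt'] are. *)
  destruct (cubic_nonzero_near (2 * c * m / r) (- 2 * m ^ 2 / r + X - c ^ 2 * Y)
    (c * m * Y) pr eps) as (pr' & Hpr & Hne); [| exact Heps |].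
  { assert (Hk0 : k <> 0) by (destruct Hk; lra).
    unfold Rdiv, m; repeat apply Rmult_integral_contrapositive_currified; auto;
      try lra; apply Rinv_neq_0_compat; lra. }
  exists r, t, pr', pt'.
  rewrite !Rminus_diag, Rabs_R0.
  refine (conj Hrt (conj Heps (conj Heps (conj Hpr (conj Hpt _))))).
  apply integrals_independent_at; auto.
  { intros ->; apply Hne; ring. }
  destruct (ttw_hamiltonian_gradient k om al be r t pr' pt' Hrt) as (-> & _).
  destruct (cartesian_integral_gradient k om al r t pr' pt' Hrt) as (-> & _).
  fold Y c; intros Hz; apply Hne.
  transitivity (pr' * 0); [| ring].
  rewrite <- Hz; unfold X, m; fold c; field; repeat split; auto; lra.
Qed.

Lemma ttw_superintegrable k om al be :
  k = 1 \/ k = -1 ->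
  multiseparable_superintegrable (ttw_region k) (ttw_potential k om al be).
Proof.
  intros Hk; exists (angular_integral k al be), (cartesian_integral k om al).
  refine (conj _ (conj _ (conj _ (conj _ _)))).
  - exists (fun _ _ => 0), (fun _ _ => 0), (fun _ _ => 1),
      (fun _ t => ttw_angular k al be t).
    split; [apply (smooth_on_eval k (Cst 0)); auto |].
    split; [apply (smooth_on_eval k (Cst 0)); auto |].
    split; [apply (smooth_on_eval k (Cst 1)); auto |].
    split.
    + apply (smooth_on_eval k (Plus (Mult (Cst al) (Mult CosInv CosInv))
        (Mult (Cst be) (Mult SinInv SinInv)))).
      intros r t (_ & _ & Hc & Hs); unfold ttw_angular; simpl; field; auto.
    + intros r t pr pt _; unfold angular_integral, ttw_angular; ring.
  (* The expanded square; the second entry is half the coefficient of [pr * pt]. *)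
  - exists (fun _ t => cos (k * t) ^ 2),
      (fun r t => - k * (cos (k * t) * sin (k * t)) / r),
      (fun r t => k ^ 2 * sin (k * t) ^ 2 / r ^ 2),
      (fun r t => - om * r ^ 2 * cos (k * t) ^ 2 + al / (r ^ 2 * cos (k * t) ^ 2)).
    split; [apply (smooth_on_eval k (Mult Cos Cos)); intros; simpl; ring |].
    split.
    { apply (smooth_on_eval k (Mult (Cst (- k)) (Mult (Mult Cos Sin) RadInv))).
      intros r t (Hr & _); simpl; field; lra. }
    split.
    { apply (smooth_on_eval k
        (Mult (Cst (k ^ 2)) (Mult (Mult Sin Sin) (Mult RadInv RadInv)))).
      intros r t (Hr & _); simpl; field; lra. }
    split.
    + apply (smooth_on_eval k
        (Plus (Mult (Cst (- om)) (Mult (Mult Rad Rad) (Mult Cos Cos)))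
          (Mult (Cst al) (Mult (Mult RadInv RadInv) (Mult CosInv CosInv))))).
      intros r t (Hr & _ & Hc & _); simpl; field; split; auto; lra.
    + intros r t pr pt (Hr & _ & Hc & _); unfold cartesian_integral.
      field; split; auto; lra.
  - apply angular_integral_first_integral.
  - now apply cartesian_integral_first_integral.
  - now apply integrals_functionally_independent.
Qed.

Theorem proposition5p1 (k : R) (hk : k <> 0) :
  (forall omega alpha beta : R,
     multiseparable_superintegrable (ttw_region k)
       (ttw_potential k omega alpha beta))
  <-> (k = 1 \/ k = -1).
Proof.
  split.
  (* One generic choice suffices: [omega] nonzero, [alpha] and [beta] positive, and [alpha <> beta]
     to exclude [k = 1/2] and [k = -1/2]. *)
  - intros Hall; apply (ttw_superintegrable_exponent k 1 1 2); auto; lra.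
  - intros Hk omega alpha beta; now apply ttw_superintegrable.
Qed.
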